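(* Let $R\in\mathbb{C}^{n\times n}$ satisfy the displacement equation $$D_{\frac1x}\,R-R\,W_Q=G\,B,$$ where $G\in\mathbb{C}^{n\times\alpha}$ and $B\in\mathbb{C}^{\alpha\times n}$. Let $C_1(n)$ be an upper bound on the complexity of solving a linear system with a matrix of the form $M_Q^{(k)}-x_kN_Q^{(k)}$, $k=1,\dots,n$, and let $C_2(n)$ be an upper bound on the complexity of performing a vector-matrix multiplication $v\cdot M_Q^{(k)}$, $k=1,\dots,n$. Then a factorization $R=P\cdot L\cdot U$, as produced by Gaussian elimination with partial pivoting ($P=P_1P_2\cdots P_n$ a product of row-interchange permutation matrices, $L$ unit lower triangular, $U$ upper triangular), can be computed, given $G$, $B$, $x_1,\dots,x_n$ and the recurrence coefficients, in $\mathcal{O}(\alpha n^2)+nC_1(n)+nC_2(n)$ operations.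
   Context: Complexity is counted in arithmetic operations over $\mathbb{C}$. $Q=\{Q_0(x),\dots,Q_{n-1}(x)\}$ is a system of polynomials with $\deg Q_k=k$ satisfying $Q_0(x)=\tau_0$ and $$Q_k(x)=\tau_k x\,Q_{k-1}(x)-a_{k-1,k}Q_{k-1}(x)-a_{k-2,k}Q_{k-2}(x)-\cdots-a_{0,k}Q_0(x),\quad k=1,\dots,n-1 .$$ $M_Q$ is the $n\times n$ unit upper triangular matrix whose $(j+1,k+1)$ entry is $a_{j,k}$ for $0\le j<k\le n-1$. $N_Q$ is the $n\times n$ matrix whose $(k,k+1)$ entry is $\tau_k$ for $k=1,\dots,n-1$ and whose other entries are zero. $W_Q=N_QM_Q^{-1}$. $x_1,\dots,x_n$ are nonzero complex numbers and $D_{\frac1x}=\mathrm{diag}(1/x_1,\dots,1/x_n)$. $M_Q^{(k)}$ and $N_Q^{(k)}$ are the submatrices of $M_Q$ and $N_Q$ obtained by deleting the first $k-1$ rows and columns. In $M_Q^{(k)}-x_kN_Q^{(k)}$, $x_k$ is the node in position $k$ after the row interchange at step $k$ of partial pivoting (interchanging two rows of $R$ interchanges the corresponding nodes and the corresponding rows of $G$). $P_k$ is the permutation matrix of the row interchange at step $k$. *)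

(* Defs.v *)
From mathcomp Require Import all_boot all_order all_algebra.

Set Implicit Arguments.
Unset Strict Implicit.
Unset Printing Implicit Defensive.

Import Order.TTheory GRing.Theory Num.Theory.
Local Open Scope ring_scope.

(* [tau] and [coef] are indexed as in the recurrence, from 0; the entry
   (j+1,k+1) of a matrix in 1-based notation is the entry (j,k) below, so that
   N_Q has tau_k at (k-1,k). *)

Record recsys (C : fieldType) (n : nat) := RecSys {
  rs_poly : 'I_n -> {poly C};
  tau : 'I_n -> C;
  coef : 'I_n -> 'I_n -> C;  (* only [coef j k] with j < k is meaningful *)
  size_rs_poly : forall k : 'I_n, size (rs_poly k) = k.+1;
  rs_poly0 : forall k : 'I_n, k = 0%N :> nat -> rs_poly k = (tau k)%:P;
  rs_polyS : forall j k : 'I_n, k = j.+1 :> nat ->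
    rs_poly k = tau k *: ('X * rs_poly j)
                - \sum_(i < n | (i < k)%N) coef i k *: rs_poly i
}.

Section Matrices.
Variables (C : fieldType) (n : nat).
Implicit Type Q : recsys C n.

Definition M_mx Q : 'M[C]_n :=
  \matrix_(j, k) if (j < k)%N then coef Q j k else (j == k)%:R.

Definition N_mx Q : 'M[C]_n :=
  \matrix_(j, k) if j.+1 == k :> nat then tau Q k else 0.

Definition W_mx Q : 'M[C]_n := N_mx Q *m invmx (M_mx Q).

Definition Dinv_mx (x : 'I_n -> C) : 'M[C]_n := diag_mx (\row_i (x i)^-1).

Lemma trail_ord_proof (d : nat) (i : 'I_(n - d)) : (d + i < n)%N.
Proof. by rewrite -ltn_subRL. Qed.

Definition trail_ord (d : nat) (i : 'I_(n - d)) : 'I_n :=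
  Ordinal (trail_ord_proof i).

(* [A] without its first [d] rows and columns: [A^(k)] is [trail_mx k.-1 A]. *)
Definition trail_mx (d : nat) (A : 'M[C]_n) : 'M[C]_(n - d) :=
  mxsub (@trail_ord d) (@trail_ord d) A.

End Matrices.

(* Gaussian elimination with partial pivoting, in compact storage: the
   multipliers overwrite the entries they annihilate, so that a later row
   interchange carries them along. *)

Section GEPP.
Variables (C : numFieldType) (n : nat).
Implicit Types (A P L U : 'M[C]_n) (k q : 'I_n).

Definition partial_pivot k q A : Prop :=
  (k <= q)%N /\ forall i : 'I_n, (k <= i)%N -> `|A i k| <= `|A q k|.

(* If the selected pivot is 0 then the column is 0 from row k down, all
   multipliers are 0 / 0 = 0, and the step changes nothing else. *)
Definition gepp_step k q A : 'M[C]_n :=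
  let A' := xrow k q A in
  \matrix_(i, j)
    if (i <= k)%N || (j < k)%N then A' i j
    else if j == k then A' i k / A' k k
    else A' i j - A' i k / A' k k * A' k j.

Definition unit_lower A : 'M[C]_n :=
  \matrix_(i, j) if (j < i)%N then A i j else (i == j)%:R.

Definition upper A : 'M[C]_n :=
  \matrix_(i, j) if (i <= j)%N then A i j else 0.

Definition gepp A P L U : Prop :=
  exists (S : nat -> 'M[C]_n) (q : 'I_n -> 'I_n),
    [/\ S 0%N = A,
        forall k : 'I_n, partial_pivot k (q k) (S k)
                         /\ S k.+1 = gepp_step k (q k) (S k),
        P = \big[mulmx/1%:M]_(k < n) tperm_mx k (q k),
        L = unit_lower (S n)
      & U = upper (S n)].

End GEPP.

(* Algebraic computation trees over C, with input variables V and output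
   positions O.  [Arith] and [Const] add one variable, [None], to the
   context; [Test x y] branches on |x| <= |y|, which partial pivoting needs.
   Division by 0 makes a run fail, unlike the total division of the field. *)

Inductive arith_op := Add | Sub | Mul | Div.

Inductive act (C O V : Type) : Type :=
| Output (f : O -> V)
| Const (c : C) (t : act C O (option V))
| Arith (op : arith_op) (x y : V) (t : act C O (option V))
| Test (x y : V) (tle tgt : act C O V).

(* Worst-case number of arithmetic operations, plus w per modulus comparison. *)
Fixpoint cost (C O V : Type) (w : nat) (t : act C O V) : nat :=
  match t with
  | Output _ => 0
  | Const _ t => cost w t
  | Arith _ _ _ t => (cost w t).+1
  | Test _ _ t1 t2 => w + maxn (cost w t1) (cost w t2)
  end%N.

Section Semantics.
Variable C : numFieldType.

Definition eval_op (op : arith_op) (a b : C) : option C :=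
  match op with
  | Add => Some (a + b)
  | Sub => Some (a - b)
  | Mul => Some (a * b)
  | Div => if b == 0 then None else Some (a / b)
  end.

Definition extend (V : Type) (e : V -> C) (c : C) (v : option V) : C :=
  if v is Some v' then e v' else c.

Fixpoint run (O V : Type) (t : act C O V) : (V -> C) -> option (O -> C) :=
  match t with
  | Output f => fun e => Some (fun o => e (f o))
  | Const c t => fun e => run t (extend e c)
  | Arith op x y t => fun e =>
      if eval_op op (e x) (e y) is Some c then run t (extend e c) else None
  | Test x y t1 t2 => fun e =>
      if `|e x| <= `|e y| then run t1 e else run t2 e
  end.

End Semantics.

Inductive coef_var (n : nat) :=
| VTau of 'I_n
| VCoef (j k : 'I_n) of (j < k)%N.

Inductive mul_var (n m : nat) :=
| MulCoef of coef_var n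
| MulVec of 'I_m.

Inductive solve_var (n m : nat) :=
| SolveCoef of coef_var n
| SolveNode
| SolveRhs of 'I_m.

Inductive lu_var (n alpha : nat) :=
| LUCoef of coef_var n
| LUNode of 'I_n
| LUG of 'I_n & 'I_alpha
| LUB of 'I_alpha & 'I_n.

Inductive lu_out (n : nat) :=
| OutP of 'I_n & 'I_n
| OutL of 'I_n & 'I_n
| OutU of 'I_n & 'I_n.

Section Problems.
Variables (C : numFieldType) (n : nat).
Implicit Types (Q : recsys C n) (x : 'I_n -> C).

Definition coef_env Q (v : coef_var n) : C :=
  match v with
  | VTau k => tau Q k
  | VCoef j k _ => coef Q j k
  end.

Definition mul_env m Q (b : 'rV[C]_m) (v : mul_var n m) : C :=
  match v with
  | MulCoef u => coef_env Q u
  | MulVec i => b 0 i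
  end.

Definition solve_env m Q (z : C) (b : 'rV[C]_m) (v : solve_var n m) : C :=
  match v with
  | SolveCoef u => coef_env Q u
  | SolveNode => z
  | SolveRhs i => b 0 i
  end.

Definition lu_env alpha Q x (G : 'M[C]_(n, alpha)) (B : 'M[C]_(alpha, n))
    (v : lu_var n alpha) : C :=
  match v with
  | LUCoef u => coef_env Q u
  | LUNode i => x i
  | LUG i j => G i j
  | LUB i j => B i j
  end.

(* [K] is the class of admissible systems and nodes: an algorithm may exploit
   structure common to the whole class (such as a short recurrence).  The d-th
   step may see any of the nodes, because of the row interchanges.  Unknown
   and right-hand side are rows, as in the product v * M. *)
Definition solve_bound (w : nat) (K : recsys C n -> ('I_n -> C) -> Prop)
    (N : nat) : Prop :=
  forall d : 'I_n,
  exists t : act C 'I_(n - d) (solve_var n (n - d)),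
    (cost w t <= N)%N /\
    forall Q x, K Q x -> forall (i : 'I_n) (b : 'rV[C]_(n - d)),
    exists y, run t (solve_env Q (x i) b) = Some y /\
      (\row_j y j) *m (trail_mx d (M_mx Q) - x i *: trail_mx d (N_mx Q)) = b.

Definition mul_bound (w : nat) (K : recsys C n -> ('I_n -> C) -> Prop)
    (N : nat) : Prop :=
  forall d : 'I_n,
  exists t : act C 'I_(n - d) (mul_var n (n - d)),
    (cost w t <= N)%N /\
    forall Q x, K Q x -> forall b : 'rV[C]_(n - d),
    exists y, run t (mul_env Q b) = Some y /\
      \row_j y j = b *m trail_mx d (M_mx Q).

Definition plu_bound (w alpha : nat) (K : recsys C n -> ('I_n -> C) -> Prop)
    (N : nat) : Prop :=
  exists t : act C (lu_out n) (lu_var n alpha),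
    (cost w t <= N)%N /\
    forall Q x, K Q x ->
    forall (A : 'M[C]_n) (G : 'M[C]_(n, alpha)) (B : 'M[C]_(alpha, n)),
    Dinv_mx x *m A - A *m W_mx Q = G *m B ->
    exists y, run t (lu_env Q x G B) = Some y /\
      let P := \matrix_(i, j) y (OutP i j) in
      let L := \matrix_(i, j) y (OutL i j) in
      let U := \matrix_(i, j) y (OutU i j) in
      A = P *m L *m U /\ gepp A P L U.

End Problems.

(* Main.v *)
From HB Require Import structures.
From mathcomp Require Import all_boot all_order all_algebra.
From mathcomp Require Import fingroup perm reals complex boolp ring zify.
Require Import Defs.

(** The factorization is the Gohberg-Kailath-Olshevsky elimination: the
    remaining Schur complement is never formed, only a generator of it.

    Write T for the matrix that agrees with the current elimination array on
    the rows and columns k, k+1, ... and is zero elsewhere.  Keeping T at full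
    size makes the displacement equation D T - T W = G B a plain n x n identity
    at every step.  As W is strictly upper triangular and T vanishes before
    column k, that column of the identity reads D T e_k = G B e_k, so the pivot
    column costs O(alpha n) ([generated_col]).  Row k, multiplied by M, reads
      r (M - x_k N) = x_k g_k B M,
    so the pivot row costs one product by M and one solution with M - x_k N,
    both on the trailing block only, as all rows in play vanish before
    position k ([generated_row_solve], [attains_solve]).  One elimination step
    replaces T by T - c r, with c the column of multipliers, and the rank-one
    changes G - c g_k and B - (1/p) b_k r, with p the pivot, generate the new
    T ([displacement_schur]).  A row interchange permutes the nodes and the
    rows of G and leaves W and B alone ([displacement_xrow]).  If the pivot is
    0, maximality makes the whole column 0, c = e_k is the right choice and B
    does not change, so that the division by p is never executed.

    That the eliminated entries assemble into A = P L U rests on the same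
    identity T' = T - c r: what T loses is exactly what the product of the
    finished columns of L and rows of U gains ([gepp_run_factor]).

    The algebraic computation tree is not written down.  A context records
    which inputs can still reach a node of the tree and which functions of the
    input have been computed there; [attains Phi N Gam] says that from the
    context Gam the property Phi is reached on every branch at cost N.  Such
    statements compose like programs ([attains_bind]), absorb given trees as
    subroutines ([attains_run]), and the tree is extracted at the end
    ([attains_sound]).

    For alpha = 0 the budget leaves no room for any operation outside the
    subroutines; then G B = 0 forces A = 0 ([displacement_rank0]), and the
    answer is a constant. *)

Import Order.TTheory GRing.Theory Num.Theory.
Local Open Scope ring_scope.
Set Implicit Arguments.
Unset Strict Implicit.
Unset Printing Implicit Defensive.

(** * Computation trees as reachability of knowledge *)

Section Knowledge.
Variables (C : numFieldType) (I : Type).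

(** The situation at a node of a tree that reads an input [i : I]: the inputs
    whose run reaches the node, and the values at hand as functions of the
    input.  Values are sets of functions rather than variables, so that no
    renaming is needed when a tree grows. *)
Record context := MkContext {
  holds : I -> Prop;
  avail : (I -> C) -> Prop
}.
Implicit Types (Gam : context) (f g h : I -> C).

(** Equality is only required on the inputs that reach the node: a branch may
    know 0 to be a pivot that vanishes on this branch. *)
Definition known Gam f :=
  exists2 g, avail Gam g & forall i, holds Gam i -> f i = g i.

Definition refines Gam' Gam :=
  (forall i, holds Gam' i -> holds Gam i) /\
  (forall f, avail Gam f -> avail Gam' f).

Definition learn Gam h :=
  MkContext (holds Gam) (fun f => avail Gam f \/ f = h).

Definition assume Gam (H : I -> Prop) :=
  MkContext (fun i => holds Gam i /\ H i) (avail Gam).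

Lemma refines_refl Gam : refines Gam Gam. Proof. by split. Qed.

Lemma refines_trans Gam2 Gam1 Gam3 :
  refines Gam1 Gam2 -> refines Gam2 Gam3 -> refines Gam1 Gam3.
Proof. by move=> [p q] [p' q']; split=> ? ?; auto. Qed.

Lemma refines_learn Gam h : refines (learn Gam h) Gam.
Proof. by split=> //= f; left. Qed.

Lemma refines_assume Gam H : refines (assume Gam H) Gam.
Proof. by split=> //= i []. Qed.

Lemma known_refines Gam' Gam f : refines Gam' Gam -> known Gam f -> known Gam' f.
Proof.
by move=> [hG aG] [g /aG ag fg]; exists g => // i /hG; apply: fg.
Qed.

Lemma known_learn Gam h : known (learn Gam h) h.
Proof. by exists h => //; right. Qed.

Lemma eq_known Gam f g :
  (forall i, holds Gam i -> g i = f i) -> known Gam f -> known Gam g.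
Proof. by move=> gf [h ah fh]; exists h => // i Hi; rewrite gf ?fh. Qed.

Variable w : nat.

(** Every branch of some tree grown from [Gam] ends in a context satisfying
    [Phi], at cost at most [N].  The slack of [AttDone] lets the two branches
    of a test have different costs. *)
Inductive attains (Phi : context -> Prop) : nat -> context -> Prop :=
| AttDone N Gam of Phi Gam : attains Phi N Gam
| AttConst N Gam (c : C) of attains Phi N (learn Gam (fun=> c)) :
    attains Phi N Gam
| AttArith N Gam op f g h of known Gam f & known Gam g
    & (forall i, holds Gam i -> eval_op op (f i) (g i) = Some (h i))
    & attains Phi N (learn Gam h) :
    attains Phi N.+1 Gam
| AttTest N Gam f g of known Gam f & known Gam g
    & attains Phi N (assume Gam (fun i => `|f i| <= `|g i|))
    & attains Phi N (assume Gam (fun i => ~~ (`|f i| <= `|g i|))) :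
    attains Phi (w + N) Gam.


Lemma attains_leq Phi N' N Gam :
  (N <= N')%N -> attains Phi N Gam -> attains Phi N' Gam.
Proof.
move=> leNN' att; elim: att N' leNN' => {N Gam}
  [N Gam ?|N Gam c _ IH|N Gam op f g h kf kg e _ IH|N Gam f g kf kg _ IH1 _ IH2] N' le.
- exact: AttDone.
- exact/AttConst/IH.
- case: N' le => // N' le; exact: AttArith kf kg e (IH _ le).
- have leN : (N <= N' - w)%N by rewrite leq_subRL ?(leq_trans (leq_addr _ _) le).
  rewrite -(subnKC (leq_trans (leq_addr _ _) le)).
  exact: AttTest kf kg (IH1 _ leN) (IH2 _ leN).
Qed.

(** Sequential composition: the second computation may depend on the branch
    taken by the first one. *)
Lemma attains_bind (Phi Psi : context -> Prop) N1 N2 Gam :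
  attains Phi N1 Gam ->
  (forall Gam', refines Gam' Gam -> Phi Gam' -> attains Psi N2 Gam') ->
  attains Psi (N1 + N2) Gam.
Proof.
move=> att; elim: att => {N1 Gam}
  [N Gam PhiG|N Gam c _ IH|N Gam op f g h kf kg e _ IH
  |N Gam f g kf kg _ IH1 _ IH2] next.
- exact/(attains_leq (leq_addl _ _))/next/PhiG/refines_refl.
- apply: AttConst (IH _) => Gam' le'; apply: next.
  exact: refines_trans le' (refines_learn _ _).
- apply: AttArith kf kg e (IH _) => Gam' le'; apply: next.
  exact: refines_trans le' (refines_learn _ _).
- rewrite -addnA; apply: AttTest kf kg (IH1 _) (IH2 _) => Gam' le'; apply: next;
  exact: refines_trans le' (refines_assume _ _).
Qed.

Definition persistent (Phi : context -> Prop) :=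
  forall Gam' Gam, refines Gam' Gam -> Phi Gam -> Phi Gam'.

Lemma attains_refines (Phi : context -> Prop) N Gam' Gam :
  persistent Phi -> refines Gam' Gam -> attains Phi N Gam -> attains Phi N Gam'.
Proof.
move=> perPhi le att; elim: att Gam' le => {N Gam}
  [N Gam PhiG|N Gam c _ IH|N Gam op f g h kf kg e _ IH
  |N Gam f g kf kg _ IH1 _ IH2] Gam' le.
- exact/AttDone/(perPhi _ _ le).
- apply: (AttConst (c := c)); apply: IH; case: le => hG aG.
  by split=> //= f [/aG|]; auto.
- have [hG aG] := le.
  apply: (AttArith (op := op) (known_refines le kf) (known_refines le kg) (h := h)).
    by move=> i /hG; apply: e.
  by apply: IH; split=> //= f' [/aG|]; auto.
- have [hG aG] := le.
  apply: (AttTest (known_refines le kf) (known_refines le kg)).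
    by apply: IH1; split=> //= i []; auto.
  by apply: IH2; split=> //= i []; auto.
Qed.

Section Soundness.
Variables (O : Type) (Post : I -> (O -> C) -> Prop).

Definition answers Gam :=
  exists y : O -> I -> C, (forall o, known Gam (y o)) /\
    forall i, holds Gam i -> Post i (y^~ i).

(** Extraction of the tree: each rule is one node.  Choice is needed to turn
    the known functions at a leaf into output positions. *)
Theorem attains_sound N Gam :
  attains answers N Gam ->
  forall (V : Type) (env : V -> I -> C),
  (forall f, avail Gam f -> exists v, forall i, holds Gam i -> f i = env v i) ->
  exists t : act C O V, (cost w t <= N)%N /\
    forall i, holds Gam i -> exists y, run t (env^~ i) = Some y /\ Post i y.
Proof.
have known_env V (env : V -> I -> C) Gam' f :
    (forall f, avail Gam' f -> exists v, forall i, holds Gam' i -> f i = env v i) ->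
    known Gam' f -> exists v, forall i, holds Gam' i -> f i = env v i.
  move=> sub [g /sub[v gv] fg]; exists v => i Hi; rewrite fg //; exact: gv.
have extendE V (env : V -> I -> C) h i :
    extend (env^~ i) (h i) = (fun v => (if v is Some u then env u else h) i).
  by apply: funext => -[].
have sub_learn V (env : V -> I -> C) Gam' h :
    (forall f, avail Gam' f -> exists v, forall i, holds Gam' i -> f i = env v i) ->
    forall f, avail (learn Gam' h) f -> exists v : option V,
    forall i, holds Gam' i -> f i = (if v is Some u then env u else h) i.
  move=> sub f /= [/sub[v fv]|->]; last by exists None.
  by exists (Some v).
elim=> {N Gam} [N Gam [y [ky Py]]|N Gam c _ IH|N Gam op f g h kf kg e _ IH
  |N Gam f g kf kg _ IH1 _ IH2] V env sub.
- have [pos posP] := choice (fun o => known_env _ _ _ _ sub (ky o)).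
  exists (Output C pos); split=> // i Hi; exists (y^~ i); split; last exact: Py.
  by congr Some; apply: funext => o; rewrite -posP.
- have [t [ct tP]] := IH _ _ (sub_learn _ _ _ _ sub).
  exists (Const c t); split=> // i Hi; have [z [rz Pz]] := tP i Hi.
  by exists z; split=> //=; rewrite (extendE _ _ (fun=> c)).
- have [[u fu] [v gv]] := (known_env _ _ _ _ sub kf, known_env _ _ _ _ sub kg).
  have [t [ct tP]] := IH _ _ (sub_learn _ _ _ _ sub).
  exists (Arith op u v t); split=> // i Hi; have [z [rz Pz]] := tP i Hi.
  by exists z; split=> //=; rewrite -fu // -gv // e // extendE.
have [[u fu] [v gv]] := (known_env _ _ _ _ sub kf, known_env _ _ _ _ sub kg).
case: (IH1 V env) => [h /sub[? E]|t1 [ct1 tP1]].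
  by eexists => i [Hi _]; apply: E.
case: (IH2 V env) => [h /sub[? E]|t2 [ct2 tP2]].
  by eexists => i [Hi _]; apply: E.
exists (Test u v t1 t2); split=> [|i Hi /=].
  by rewrite leq_add2l geq_max ct1.
rewrite -fu // -gv //; case: ifPn => le_fg; first exact: tP1.
exact: tP2.
Qed.

End Soundness.

Section Algorithms.

Lemma attains_cst Gam c : attains (known^~ (fun=> c)) 0 Gam.
Proof. by apply: AttConst; apply: AttDone; apply: known_learn. Qed.

Lemma persistent_known f : persistent (known^~ f).
Proof. by move=> ? ? le; apply: known_refines. Qed.

Lemma attains_arith op Gam k1 k2 f g h :
  attains (known^~ f) k1 Gam -> attains (known^~ g) k2 Gam ->
  (forall i, holds Gam i -> eval_op op (f i) (g i) = Some (h i)) ->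
  attains (known^~ h) (k1 + k2).+1 Gam.
Proof.
move=> af ag e; rewrite -addn1 -addnA.
apply: attains_bind af _ => Gam1 le1 kf.
apply: attains_bind (attains_refines (@persistent_known g) le1 ag) _ => Gam2 le2 kg.
apply: (AttArith (op := op) (h := h) (known_refines le2 kf) kg) => [i /le2.1/le1.1|].
  exact: e.
exact/AttDone/known_learn.
Qed.

Lemma attains_add Gam k1 k2 f g :
  attains (known^~ f) k1 Gam -> attains (known^~ g) k2 Gam ->
  attains (known^~ (fun i => f i + g i)) (k1 + k2).+1 Gam.
Proof.
move=> af ag.
by apply: (attains_arith (op := Add) (h := fun i => f i + g i) af ag).
Qed.

Lemma attains_sub Gam k1 k2 f g :
  attains (known^~ f) k1 Gam -> attains (known^~ g) k2 Gam ->
  attains (known^~ (fun i => f i - g i)) (k1 + k2).+1 Gam.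
Proof.
move=> af ag.
by apply: (attains_arith (op := Defs.Sub) (h := fun i => f i - g i) af ag).
Qed.

Lemma attains_mul Gam k1 k2 f g :
  attains (known^~ f) k1 Gam -> attains (known^~ g) k2 Gam ->
  attains (known^~ (fun i => f i * g i)) (k1 + k2).+1 Gam.
Proof.
move=> af ag.
by apply: (attains_arith (op := Mul) (h := fun i => f i * g i) af ag).
Qed.

Lemma attains_div Gam k1 k2 f g :
  attains (known^~ f) k1 Gam -> attains (known^~ g) k2 Gam ->
  (forall i, holds Gam i -> g i != 0) ->
  attains (known^~ (fun i => f i / g i)) (k1 + k2).+1 Gam.
Proof.
move=> af ag g0.
apply: (attains_arith (op := Div) (h := fun i => f i / g i) af ag) => i /g0 /=.
by case: eqP.
Qed.

Lemma eq_attains Gam k f g :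
  (forall i, holds Gam i -> g i = f i) ->
  attains (known^~ f) k Gam -> attains (known^~ g) k Gam.
Proof.
move=> gf af; rewrite -(addn0 k); apply: attains_bind af _ => Gam' le kf.
by apply/AttDone/eq_known/kf => i /le.1; apply: gf.
Qed.

Lemma attains_family (J : finType) (F : J -> I -> C) k Gam :
  (forall j, attains (known^~ (F j)) k Gam) ->
  attains (fun Gam' => forall j, known Gam' (F j)) (#|J| * k) Gam.
Proof.
move=> aF.
suff aS (s : seq J) :
    attains (fun Gam' => forall j, j \in s -> known Gam' (F j)) (size s * k) Gam.
  rewrite cardE -(addn0 (size _ * k)%N); apply: attains_bind (aS (enum J)) _ => Gam' _ kF.
  by apply: AttDone => j; apply: kF; rewrite mem_enum.
elim: s => [|j s IH] /=; first by apply: AttDone.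
rewrite mulSn addnC; apply: attains_bind IH _ => Gam1 le1 kF.
rewrite -(addn0 k).
apply: attains_bind (attains_refines (@persistent_known _) le1 (aF j)) _ => Gam2 le2 kj.
apply: AttDone => j'; rewrite inE => /predU1P[-> // | /kF].
exact: known_refines.
Qed.

(** Call of a subroutine given as a tree: its nodes are replayed, with inputs
    substituted by known functions.  Only the inputs that reach the caller need
    to run successfully. *)
Lemma attains_run (O V : Type) (t : act C O V) Gam
    (s : V -> I -> C) (r : O -> I -> C) :
  (forall v, known Gam (s v)) ->
  (forall i, holds Gam i -> run t (s^~ i) = Some (r^~ i)) ->
  attains (fun Gam' => forall o, known Gam' (r o)) (cost w t) Gam.
Proof.
have known_cons V' (s' : V' -> I -> C) Gam' h : (forall v, known Gam' (s' v)) ->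
    forall v, known (learn Gam' h) (if v is Some u then s' u else h).
  move=> ks [v|]; last exact: known_learn.
  exact: known_refines (refines_learn _ _) (ks v).
have extendE V' (s' : V' -> I -> C) h i :
    extend (s'^~ i) (h i) = (fun v => (if v is Some u then s' u else h) i).
  by apply: funext => -[].
elim: t Gam s => {V} [V f|V c t IH|V op x y t IH|V x y t1 IH1 t2 IH2] Gam s ks /= E.
- apply: AttDone => o; apply: eq_known (ks (f o)) => i /E[/(congr1 (@^~ o))].
  by move=> <-.
- apply: AttConst; apply: IH (known_cons _ _ _ _ ks) _ => i /E <-.
  by rewrite (extendE _ _ (fun=> c)).
(* The default 0 stands for no value: a run that succeeds never divides by 0. *)
- pose h i := odflt 0 (eval_op op (s x i) (s y i)).
  have hE i : holds Gam i -> eval_op op (s x i) (s y i) = Some (h i).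
    by move/E; rewrite /h; case: (eval_op op _ _).
  apply: (AttArith (ks x) (ks y) hE); apply: IH (known_cons _ _ _ _ ks) _ => i Hi.
  by rewrite -extendE -E // hE.
apply: AttTest (ks x) (ks y) _ _.
  apply: (attains_leq (leq_maxl _ _)); apply: IH1 => [v|i [/E Ei le_xy]].
    exact: known_refines (refines_assume _ _) (ks v).
  by rewrite -Ei le_xy.
apply: (attains_leq (leq_maxr _ _)); apply: IH2 => [v|i [/E Ei /negbTE le_xy]].
  exact: known_refines (refines_assume _ _) (ks v).
by rewrite -Ei le_xy.
Qed.
End Algorithms.
End Knowledge.
Arguments known {C I}.

(** * Displacement structure under elimination *)

Section Displacement.
Variables (C : fieldType) (n : nat).
Implicit Types (Q : recsys C n) (T W : 'M[C]_n) (k : 'I_n).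

Lemma M_mx_unit Q : M_mx Q \in unitmx.
Proof.
rewrite unitmxE -det_tr det_trig; last first.
  by apply/is_trig_mxP => i j lt_ij; rewrite !mxE ltnNge ltnW //= -val_eqE gtn_eqF.
by rewrite big1 ?unitr1 // => i _; rewrite !mxE ltnn eqxx.
Qed.

Lemma shifted_M_mx_unit Q d z :
  trail_mx d (M_mx Q) - z *: trail_mx d (N_mx Q) \in unitmx.
Proof.
rewrite unitmxE -det_tr det_trig; last first.
  apply/is_trig_mxP => i j lt_ij; rewrite !mxE /= ltn_add2l ltnNge ltnW //=.
  rewrite -val_eqE /= eqn_add2l gtn_eqF //.
  by rewrite gtn_eqF ?mulr0 ?subr0 // ltnS leq_add2l ltnW.
rewrite big1 ?unitr1 // => i _.
by rewrite !mxE /= ltnn eqxx gtn_eqF // mulr0 subr0.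
Qed.

Lemma W_mxK Q : W_mx Q *m M_mx Q = N_mx Q.
Proof. by rewrite -mulmxA mulVmx ?M_mx_unit // mulmx1. Qed.

(** [W_mx Q] is strictly upper triangular, in the form used below.  Column [j]
    of X W M = X N is column [j] of X W plus a combination of earlier columns
    of X W, while X N shifts the columns of X by one; induct on [j]. *)
Lemma mulmx_W_mx_eq0 m Q (X : 'M[C]_(m, n)) (d : nat) :
  (forall i (j : 'I_n), (j < d)%N -> X i j = 0) ->
  forall i (j : 'I_n), (j <= d)%N -> (X *m W_mx Q) i j = 0.
Proof.
move=> X0 i j; have [p le_jp] := ubnP j; elim: p j le_jp => // p IH j lt_jp le_jd.
have /matrixP/(_ i j) : X *m W_mx Q *m M_mx Q = X *m N_mx Q by rewrite -mulmxA W_mxK.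
rewrite [LHS]mxE (bigD1 j) //= [M_mx Q j j]mxE ltnn eqxx mulr1.
rewrite big1 ?addr0 => [->|l ne_lj].
  rewrite mxE big1 // => l _; rewrite [N_mx Q l j]mxE.
  case: eqP => [E|_]; last by rewrite mulr0.
  by rewrite X0 ?mul0r // (leq_trans _ le_jd) // -E.
rewrite [M_mx Q l j]mxE (negPf ne_lj); case: ltnP => [lt_lj|_]; last by rewrite mulr0.
by rewrite IH ?mul0r // ?(leq_trans lt_lj) // ltnW // (leq_trans lt_lj).
Qed.

Section Step.
Variables (Q : recsys C n) (x : 'I_n -> C) (T : 'M[C]_n) (alpha : nat).
Variables (G : 'M[C]_(n, alpha)) (B : 'M[C]_(alpha, n)) (k : 'I_n).
Hypothesis x_neq0 : forall i, x i != 0.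
Hypothesis TD : Dinv_mx x *m T - T *m W_mx Q = G *m B.
Hypothesis T0 : forall i (j : 'I_n), (j < k)%N -> T i j = 0.

(** The product with W vanishes up to column [k].  For [j < k] this says that
    G B vanishes there; for [j = k] it gives the pivot column. *)
Lemma generated_entry i (j : 'I_n) :
  (j <= k)%N -> (G *m B) i j = (x i)^-1 * T i j.
Proof.
move=> le_jk; rewrite -TD mxE [X in _ + X]mxE (mulmx_W_mx_eq0 Q T0) // subr0.
by rewrite mul_diag_mx !mxE.
Qed.

Lemma generated_col i : T i k = x i * (G *m B) i k.
Proof. by rewrite generated_entry // mulVKf. Qed.

Lemma generated_row i : row i T *m W_mx Q = (x i)^-1 *: row i T - row i G *m B.
Proof.
rewrite -!row_mul -TD /Dinv_mx mul_diag_mx; move: (T *m _) => X.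
by apply/rowP => j; rewrite !mxE opprB addrCA subrr addr0.
Qed.

(** Multiplication by [x i] and by M removes both inverses from row [i] of the
    displacement equation. *)
Lemma generated_row_solve i :
  row i T *m (M_mx Q - x i *: N_mx Q) = x i *: (row i G *m B *m M_mx Q).
Proof.
have -> : row i G *m B = (x i)^-1 *: row i T - row i T *m W_mx Q.
  by rewrite generated_row opprB addrCA subrr addr0.
rewrite mulmxBl -(mulmxA _ (W_mx Q)) W_mxK mulmxBr scalerBr -scalemxAl scalerA.
by rewrite divff // scale1r -scalemxAr.
Qed.

(** In the case of a zero pivot, column [k] is zero and the unit vector still
    makes [T - multipliers *m row k T] lose row [k] and nothing else. *)
Definition multipliers : 'cV[C]_n :=
  \col_i if T k k == 0 then (i == k)%:R else T i k / T k k.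

(** With c the multipliers, r, g, b row [k] of T and G and column [k] of B, and
    p the pivot, r W = D_k r - g B turns the left-hand side into
    G B - c g B - (D c - D_k c) r, and D c - D_k c = (1/p) (G - c g) b: for
    nonzero p because D (p c) = G b and g b = D_k p, for p = 0 because c = e_k
    makes both sides vanish. *)
Lemma displacement_schur :
  (T k k = 0 -> forall i, T i k = 0) ->
  let T' := T - multipliers *m row k T in
  Dinv_mx x *m T' - T' *m W_mx Q =
  (G - multipliers *m row k G) *m
  (B - (T k k)^-1 *: col k B *m row k T).
Proof.
move=> Tkk0 /=; set c := multipliers; set r := row k T; set g := row k G.
have Gb : G *m col k B = Dinv_mx x *m col k T.
  rewrite colE mulmxA -colE /Dinv_mx mul_diag_mx; apply/colP => i.
  by rewrite [LHS]mxE generated_entry // !mxE.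
have gb : g *m col k B = ((x k)^-1 * T k k)%:M.
  rewrite -row_mul Gb /Dinv_mx mul_diag_mx; apply/rowP => j.
  by rewrite (ord1 j) !mxE eqxx mulr1n.
(* With p = 0 the right-hand side is 0, as the inverse of 0 is 0. *)
have Dc : Dinv_mx x *m c - (x k)^-1 *: c = (G - c *m g) *m ((T k k)^-1 *: col k B).
  rewrite -scalemxAr mulmxBl -mulmxA gb mul_mx_scalar Gb.
  apply/colP => i; rewrite !mul_diag_mx !mxE; have [p0|p0] := eqVneq.
    by rewrite p0 invr0 mul0r; case: eqP => [->|_]; rewrite ?mulr0 subrr.
  by field; rewrite p0 !x_neq0.
have -> : (G - c *m g) *m (B - (T k k)^-1 *: col k B *m r) =
    G *m B - c *m (g *m B) - (Dinv_mx x *m c *m r - (x k)^-1 *: (c *m r)).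
  rewrite mulmxBr (mulmxA _ (_ *: _)) -Dc (mulmxBl (Dinv_mx x *m c)) -scalemxAl.
  by rewrite mulmxBl (mulmxA c).
rewrite mulmxBr mulmxBl -TD -(mulmxA c) generated_row mulmxBr -scalemxAr mulmxA.
rewrite (mulmxA (Dinv_mx x)) -/r.
move: (Dinv_mx x *m T) (T *m _) (_ *m c *m r) (_ *: _) (c *m g *m B).
move=> X1 X2 X3 X4 X5.
by apply/matrixP => i j; rewrite !mxE; ring.
Qed.
End Step.
End Displacement.

(** * Partial pivoting on the elimination array *)

(** Makes the splitting lemmas for iterated products available for [mulmx]
    itself, on square matrices of any size. *)
HB.instance Definition _ (R : pzSemiRingType) (n : nat) :=
  Monoid.isLaw.Build 'M[R]_n 1%:M mulmx (@mulmxA R n n n n) (@mul1mx R n n)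
    (@mulmx1 R n n).

Section Elimination.
Variables (C : numFieldType) (n : nat).
Implicit Types (A S P : 'M[C]_n) (k q : 'I_n) (d : nat).

(** The Schur complement still to be factored, padded with zeros to full
    size. *)
Definition trailing d S : 'M[C]_n :=
  \matrix_(i, j) if (d <= i)%N && (d <= j)%N then S i j else 0.

(** The product of the finished columns of L and the finished rows of U. *)
Definition peeled d S : 'M[C]_n :=
  \matrix_(i, j) \sum_(l < n | (l < d)%N) unit_lower S i l * upper S l j.

(** Prefixes of a run of [gepp], in the form that allows induction on the number
    of steps; the last matrix is the compact storage. *)
Inductive gepp_run A : nat -> 'M[C]_n -> 'M[C]_n -> Prop :=
| GeppStart : gepp_run A 0 1%:M A
| GeppStep k q P S of gepp_run A k P S & partial_pivot k q S :
    gepp_run A k.+1 (P *m tperm_mx k q) (gepp_step k q S).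

(** Maximality of the pivot: if it is zero, so is the column below it. *)
Lemma pivot_eq0 k q S (i : 'I_n) :
  partial_pivot k q S -> xrow k q S k k = 0 -> (k <= i)%N -> xrow k q S i k = 0.
Proof.
move=> [le_kq max_q]; rewrite !mxE tpermL => Sqk0 le_ki.
suff /max_q : (k <= tperm k q i)%N by rewrite Sqk0 normr0 normr_le0 => /eqP.
by case: tpermP.
Qed.

Lemma trailing_xrow d k q S : (d <= k)%N -> (d <= q)%N ->
  trailing d (xrow k q S) = xrow k q (trailing d S).
Proof.
move=> le_dk le_dq; apply/matrixP => i j; rewrite !mxE.
by case: tpermP => [->|->|//]; rewrite le_dk le_dq.
Qed.

Lemma peeled_xrow d k q S : (d <= k)%N -> (d <= q)%N ->
  peeled d (xrow k q S) = xrow k q (peeled d S).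
Proof.
move=> le_dk le_dq; apply/matrixP => i j; rewrite !mxE.
apply: eq_bigr => l lt_ld; rewrite !mxE.
have [ltlk ltlq] := (leq_trans lt_ld le_dk, leq_trans lt_ld le_dq).
have -> : tperm k q l = l by rewrite tpermD // -val_eqE gtn_eqF.
congr (_ * _); case: tpermP => [->|->|//].
  by rewrite ltlk ltlq.
by rewrite ltlk ltlq.
Qed.

Lemma trailing_gepp_step k q S : partial_pivot k q S ->
  let T := trailing k (xrow k q S) in
  trailing k.+1 (gepp_step k q S) = T - multipliers T k *m row k T.
Proof.
move=> piv T; apply/matrixP => i j.
have Tkk : T k k = xrow k q S k k by rewrite mxE leqnn.
rewrite [trailing _ _ _ _]mxE [in RHS]mxE [X in _ + X]mxE [X in - X]mxE big_ord1.
rewrite [row _ _ _ _]mxE [multipliers _ _ _ _]mxE Tkk.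
case: (ltngtP k i) => [lt_ki|lt_ik|/val_inj <-] /=.
- have T0 : xrow k q S k k = 0 -> T i k = 0.
    by move=> p0; rewrite mxE leqnn (ltnW lt_ki) pivot_eq0 // ltnW.
  rewrite [gepp_step _ _ _ _ _]mxE [(i <= k)%N]leqNgt lt_ki /=.
  rewrite [T i j]mxE (ltnW lt_ki) [T k j]mxE leqnn [T i k]mxE (ltnW lt_ki) leqnn /=.
  move: T0; rewrite [T i k]mxE (ltnW lt_ki) leqnn /= => T0.
  case: (ltngtP k j) => [lt_kj|lt_jk|/val_inj <-] /=.
  + rewrite -val_eqE /= (gtn_eqF lt_kj); case: eqP => [p0|_ //].
    by rewrite T0 // mul0r mul0r -val_eqE (gtn_eqF lt_ki) mul0r.
  + by rewrite mulr0 subr0.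
  case: eqP => [p0|/eqP p0]; first by rewrite T0 // p0 mulr0 subr0.
  by rewrite divfK // subrr.
- have Ti j' : T i j' = 0 by rewrite mxE [(k <= i)%N]leqNgt lt_ik.
  by rewrite !Ti mul0r -val_eqE (ltn_eqF lt_ik) if_same mul0r subr0.
by rewrite -Tkk; case: eqP => [_|/eqP p0]; rewrite ?eqxx ?divff // mul1r subrr.
Qed.

(** Column [k] of L is the vector of multipliers and row [k] of U is the pivot
    row, so the new summand is the rank-one matrix that the trailing part
    loses.  A zero pivot is consistent with this: compact storage holds
    0 / 0 = 0 below the diagonal, as the unit vector does. *)
Lemma peeled_gepp_step k q S : partial_pivot k q S ->
  let T := trailing k (xrow k q S) in
  peeled k.+1 (gepp_step k q S) =
  peeled k (xrow k q S) + multipliers T k *m row k T.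
Proof.
move=> piv T; apply/matrixP => i j.
have Tkk : T k k = xrow k q S k k by rewrite mxE leqnn.
rewrite [peeled _ _ _ _]mxE [in RHS]mxE [X in _ = X + _]mxE [X in _ + X]mxE big_ord1.
rewrite (bigD1 k) //= addrC; congr (_ + _).
  have eq_k (l : 'I_n) : (l < k.+1)%N && (l != k) = (l < k)%N.
    by rewrite ltnS [RHS]ltn_neqAle andbC.
  rewrite (eq_bigl _ _ eq_k); apply: eq_bigr => l lt_lk.
  rewrite ![unit_lower _ _ _]mxE ![upper _ _ _]mxE ![gepp_step _ _ _ _ _]mxE.
  by rewrite lt_lk (ltnW lt_lk) orbT.
rewrite [row _ _ _ _]mxE [multipliers _ _ _ _]mxE [T k j]mxE leqnn /=.
rewrite [upper _ _ _]mxE [unit_lower _ _ _]mxE ![gepp_step _ _ _ _ _]mxE leqnn /=.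
case: (boolP (k <= j)%N) => le_kj; last by rewrite !mulr0.
congr (_ * _); rewrite Tkk eqxx [T i k]mxE leqnn andbT ltnn orbF.
case: (ltngtP k i) => [lt_ki|lt_ik|/val_inj <-] /=.
- case: eqP => // p0.
  by rewrite (pivot_eq0 piv p0 (ltnW lt_ki)) mul0r -val_eqE gtn_eqF.
- by rewrite -val_eqE ltn_eqF // mul0r if_same.
by rewrite eqxx; case: eqP => // /eqP p0; rewrite divff.
Qed.

(** The interchange is an involution that commutes with [peeled] and
    [trailing], and the elimination moves one rank-one matrix from the second
    to the first. *)
Lemma gepp_run_factor A d P S :
  gepp_run A d P S -> A = P *m (peeled d S + trailing d S).
Proof.
elim=> {d P S} [|k q P S _ -> piv].
  rewrite mul1mx; apply/matrixP => i j; rewrite !mxE big1 ?add0r //.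
have [le_kq _] := piv.
(* The rank-one matrices cancel; then two equal transpositions do. *)
rewrite peeled_gepp_step // trailing_gepp_step // addrACA subrr addr0.
rewrite peeled_xrow // trailing_xrow // !xrowE -mulmxDr mulmxA.
by rewrite -(mulmxA P) -perm_mxM tperm2 perm_mx1 mulmx1.
Qed.

Lemma gepp_run_spec A P S : gepp_run A n P S ->
  gepp A P (unit_lower S) (upper S) /\ A = P *m unit_lower S *m upper S.
Proof.
move=> run; split; last first.
  rewrite [LHS](gepp_run_factor run) -mulmxA; congr (_ *m _).
  apply/matrixP => i j; rewrite !mxE leqNgt ltn_ord addr0.
  by apply: eq_bigl => l; rewrite ltn_ord.
suff stages d : gepp_run A d P S ->
    exists (S' : nat -> 'M[C]_n) (q : 'I_n -> 'I_n),
    [/\ S' 0%N = A,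
        forall k : 'I_n, (k < d)%N -> partial_pivot k (q k) (S' k)
                         /\ S' k.+1 = gepp_step k (q k) (S' k),
        P = \big[mulmx/1%:M]_(k < n | (k < d)%N) tperm_mx k (q k) & S' d = S].
  have [S' [q [S'0 S'S -> <-]]] := stages n run.
  exists S', q; split=> //; first by move=> k; apply: S'S.
  by apply: eq_bigl => k; rewrite ltn_ord.
move=> {}run; elim: run => {P S} [|k q P S _ [S' [q' [S'0 S'S -> <-]]] piv].
  by exists (fun=> A), id; split=> //; rewrite big_pred0.
exists (fun m => if (m <= k)%N then S' m else gepp_step k q (S' k)).
exists (fun j => if j == k then q else q' j); split=> //.
- move=> j /=; rewrite ltnS -val_eqE /=.
  by case: ltngtP => // [lt_jk|/val_inj ->] _; first exact: S'S.
- rewrite (big_ord_narrow (ltn_ord k)) big_ord_recr /=.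
  rewrite (big_ord_narrow (ltnW (ltn_ord k))).
  congr (_ *m _); last first.
    by rewrite (_ : widen_ord _ _ = k) ?eqxx //; apply: val_inj.
  apply: eq_bigr => l _; rewrite -val_eqE /= ltn_eqF //.
  by congr (tperm_mx _ _); [|congr q']; apply: val_inj.
by rewrite ltnn.
Qed.

Lemma gepp_run0 d : (d <= n)%N -> gepp_run 0 d 1%:M 0.
Proof.
elim: d => [|d IH] lt_dn; first exact: GeppStart.
pose k := Ordinal lt_dn.
have piv : partial_pivot k k (0 : 'M[C]_n).
  by split=> // i _; rewrite !mxE.
have := @GeppStep 0 k k 1%:M 0 (IH (ltnW lt_dn)) piv.
rewrite mul1mx /tperm_mx tperm1 perm_mx1.
rewrite (_ : gepp_step k k 0 = 0) //; apply/matrixP => i j; rewrite !mxE.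
by case: ifP => // _; case: ifP; rewrite !mul0r ?subr0.
Qed.

End Elimination.


(** * Computing with matrices of known entries *)

Section MatrixAlgorithms.
Variables (C : numFieldType) (I : Type) (w : nat).
Implicit Type Gam : context C I.

Definition mx_known m p (F : I -> 'M[C]_(m, p)) Gam :=
  forall i j, known Gam (fun s => F s i j).

Lemma mx_known_refines m p (F : I -> 'M[C]_(m, p)) Gam' Gam :
  refines Gam' Gam -> mx_known F Gam -> mx_known F Gam'.
Proof. by move=> le kF i j; apply: known_refines le _. Qed.

Lemma eq_mx_known m p (F F' : I -> 'M[C]_(m, p)) Gam :
  (forall s, holds Gam s -> F' s = F s) -> mx_known F Gam -> mx_known F' Gam.
Proof. by move=> eqF kF i j; apply: eq_known (kF i j) => s /eqF->. Qed.

Lemma attains_known f Gam : known Gam f -> attains w (known^~ f) 0 Gam.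
Proof. by move=> kf; apply: AttDone. Qed.

Lemma attains_mx m p (F : I -> 'M[C]_(m, p)) c Gam :
  (forall i j, attains w (known^~ (fun s => F s i j)) c Gam) ->
  attains w (mx_known F) (m * p * c) Gam.
Proof.
move=> aF; pose F1 (ij : 'I_m * 'I_p) s := F s ij.1 ij.2.
have := @attains_family _ _ w _ F1 c Gam; rewrite card_prod !card_ord => fam.
rewrite -(addn0 (_ * c)%N); apply: attains_bind (fam _) _ => [[i j]|Gam' _ kF1].
  exact: aF.
by apply: AttDone => i j; apply: (kF1 (i, j)).
Qed.

Lemma attains_mulmx m p r (X : I -> 'M[C]_(m, p)) (Y : I -> 'M[C]_(p, r)) Gam :
  mx_known X Gam -> mx_known Y Gam ->
  attains w (mx_known (fun s => X s *m Y s)) (m * r * (p * 2)) Gam.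
Proof.
move=> kX kY; apply: attains_mx => i j.
suff sum_seq (ls : seq 'I_p) :
    attains w (known^~ (fun s => \sum_(l <- ls) X s i l * Y s l j)) (size ls * 2) Gam.
  have := sum_seq (enum 'I_p); rewrite size_enum_ord; apply: eq_attains => s _.
  by rewrite mxE big_enum.
elim: ls => [|l ls IH].
  by apply: eq_attains (attains_cst w Gam 0) => s _; rewrite big_nil.
have := attains_add (attains_mul (attains_known (kX i l)) (attains_known (kY l j))) IH.
by rewrite mulSn; apply: eq_attains => s _; rewrite big_cons.
Qed.

(** Linear search with the current best candidate [b]; each comparison is one
    test. *)
Lemma attains_pivot n k (f : 'I_n -> I -> C) Gam :
  (k < n)%N -> (forall j, known Gam (f j)) ->
  attains w (fun Gam' => exists2 q : 'I_n, (k <= q)%N &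
      forall s, holds Gam' s ->
      forall j : 'I_n, (k <= j)%N -> `|f j s| <= `|f q s|) (n * w) Gam.
Proof.
move=> lt_kn kf.
suff search (js : seq 'I_n) (b : 'I_n) Gam1 : refines Gam1 Gam -> (k <= b)%N ->
    attains w (fun Gam' => exists2 q : 'I_n, (k <= q)%N &
      forall s, holds Gam' s -> `|f b s| <= `|f q s| /\
      forall j, j \in js -> (k <= j)%N -> `|f j s| <= `|f q s|) (size js * w) Gam1.
  rewrite -[n in X in attains _ _ X _](size_enum_ord n) -(addn0 (_ * w)%N).
  apply: attains_bind (search _ (Ordinal lt_kn) _ (refines_refl _) (leqnn k)) _.
  move=> Gam1 _ [q le_kq max_q]; apply: AttDone; exists q => // s /max_q[_ max_s] j.
  by apply: max_s; rewrite mem_enum.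
elim: js b Gam1 => [|j js IH] b Gam1 le1 le_kb.
  by apply: AttDone; exists b.
have [lt_jk|le_kj] := ltnP j k.
  apply: (@attains_leq _ _ _ _ _ (size js * w)); first by rewrite leq_mul2r leqnSn orbT.
  rewrite -(addn0 (_ * w)%N); apply: attains_bind (IH b Gam1 le1 le_kb) _.
  move=> Gam2 _ [q le_kq max_q]; apply: AttDone; exists q => // s /max_q[max_b max_s].
  split=> // j'; rewrite inE => /predU1P[->|]; last exact: max_s.
  by rewrite leqNgt lt_jk.
rewrite mulSn; apply: AttTest (known_refines le1 (kf b)) (known_refines le1 (kf j)) _ _;
  set Gam2 := assume _ _.
  have le2 : refines Gam2 Gam1 by apply: refines_assume.
  rewrite -(addn0 (_ * w)%N).
  apply: attains_bind (IH j Gam2 (refines_trans le2 le1) le_kj) _.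
  move=> Gam3 le3 [q le_kq max_q]; apply: AttDone; exists q => // s Hs.
  have [max_j max_s] := max_q s Hs; have [_ le_bj] := le3.1 s Hs.
  split; first exact: le_trans le_bj max_j.
  by move=> j'; rewrite inE => /predU1P[->|] //; apply: max_s.
have le2 : refines Gam2 Gam1 by apply: refines_assume.
rewrite -(addn0 (_ * w)%N).
apply: attains_bind (IH b Gam2 (refines_trans le2 le1) le_kb) _.
move=> Gam3 le3 [q le_kq max_q]; apply: AttDone; exists q => // s Hs.
have [max_b max_s] := max_q s Hs; have [_ gt_bj] := le3.1 s Hs.
split=> // j'; rewrite inE => /predU1P[->|] //; last exact: max_s.
move=> _; apply: le_trans max_b; apply: ltW.
by rewrite real_ltNge ?normr_real.
Qed.

(** The test for a zero pivot compares moduli with the constant 0.  On the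
    branch where the pivot vanishes the multipliers are constants and B is kept;
    on the other one the divisions are legitimate. *)
Lemma attains_schur n alpha (k : 'I_n) (T : I -> 'M[C]_n)
    (G : I -> 'M[C]_(n, alpha)) (B : I -> 'M[C]_(alpha, n)) Gam :
  (forall i, known Gam (fun s => T s i k)) ->
  mx_known (fun s => row k (T s)) Gam -> mx_known G Gam -> mx_known B Gam ->
  attains w (fun Gam' =>
    [/\ mx_known (fun s => multipliers (T s) k) Gam',
        mx_known (fun s => G s - multipliers (T s) k *m row k (G s)) Gam'
      & mx_known (fun s => B s - (T s k k)^-1 *: col k (B s) *m row k (T s)) Gam'])
    (w + (n + (3 * (n * alpha) + (alpha + 3 * (alpha * n))))) Gam.
Proof.
move=> kl kr kG kB.
have kp : known Gam (fun s => T s k k) by [].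
have update m p (X Y : I -> 'M[C]_(m, p)) Gam' : mx_known X Gam' -> mx_known Y Gam' ->
    attains w (mx_known (fun s => X s - Y s)) (m * p * 1) Gam'.
  move=> kX kY; apply: attains_mx => i j.
  apply: eq_attains (attains_sub (attains_known (kX i j)) (attains_known (kY i j))).
  by move=> s _; rewrite !mxE.
have known_row m p (X : I -> 'M[C]_(m, p)) i Gam' : mx_known X Gam' ->
    mx_known (fun s => row i (X s)) Gam'.
  by move=> kX i' j; apply: eq_known (kX i j) => s _; rewrite mxE.
pose c s := multipliers (T s) k.
pose newG s := G s - c s *m row k (G s).
pose newB s := B s - (T s k k)^-1 *: col k (B s) *m row k (T s).
have attains_newG Gam' : refines Gam' Gam -> mx_known c Gam' ->
    attains w (mx_known newG) (3 * (n * alpha)) Gam'.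
  move=> le kc; have kG' := mx_known_refines le kG.
  have := attains_mulmx kc (known_row _ _ _ k _ kG'); rewrite mul1n => acG.
  rewrite (_ : 3 * _ = n * alpha * 2 + n * alpha * 1)%N; last by rewrite -mulnDr mulnC.
  apply: attains_bind acG _ => Gam2 le2 kcG; apply: update kcG.
  exact: mx_known_refines kG'.
have both Gam' : refines Gam' Gam -> attains w (mx_known c) n Gam' ->
    attains w (mx_known newB) (alpha + 3 * (alpha * n)) Gam' ->
    attains w (fun Gam'' => [/\ mx_known c Gam'', mx_known newG Gam''
      & mx_known newB Gam'']) (n + (3 * (n * alpha) + (alpha + 3 * (alpha * n)))) Gam'.
  move=> le ac aB; apply: attains_bind ac _ => Gam1 le1 kc.
  apply: attains_bind (attains_newG _ (refines_trans le1 le) kc) _ => Gam2 le2 knewG.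
  rewrite -(addn0 (alpha + _)%N).
  have aB2 := attains_refines (@mx_known_refines _ _ newB) (refines_trans le2 le1) aB.
  apply: attains_bind aB2 _ => Gam3 le3 knewB; apply: AttDone; split=> //.
    exact/(mx_known_refines (refines_trans le3 le2)).
  exact/(mx_known_refines le3).
apply: (AttConst (c := 0)); set Gam0 := learn _ _.
have le0 : refines Gam0 Gam by apply: refines_learn.
apply: AttTest (known_refines le0 kp) (known_learn _ _) _ _; set Gam1 := assume _ _;
  have le1 : refines Gam1 Gam by apply: refines_trans (refines_assume _ _) le0.
- have p0 s : holds Gam1 s -> T s k k = 0.
    by case=> _; rewrite normr0 normr_le0 => /eqP.
  apply: both => //.
    apply: (@attains_leq _ _ _ _ _ (n * 1 * 0)); first by rewrite muln0.
    apply: attains_mx => i j.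
    apply: eq_attains (attains_cst _ _ (i == k)%:R) => s Hs.
    by rewrite mxE p0 // eqxx.
  apply: (attains_leq (leq0n _)); apply: AttDone.
  apply: eq_mx_known (mx_known_refines le1 kB) => s Hs.
  by rewrite /newB p0 // invr0 scale0r mul0mx subr0.
have p0 s : holds Gam1 s -> T s k k != 0.
  by case=> _; rewrite normr0 normr_le0.
have kp1 := attains_known (known_refines le1 kp).
apply: both => //.
  have := @attains_mx n 1 c 1 Gam1; rewrite !muln1; apply=> i j.
  apply: eq_attains (attains_div (attains_known (known_refines le1 (kl i))) kp1 p0).
  by move=> s /p0 ps; rewrite mxE (negPf ps).
pose b s := (T s k k)^-1 *: col k (B s).
have ab : attains w (mx_known b) alpha Gam1.
  have := @attains_mx alpha 1 b 1 Gam1; rewrite !muln1; apply=> i j.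
  apply: eq_attains (attains_div (attains_known (known_refines le1 (kB i k))) kp1 p0).
  by move=> s _; rewrite !mxE mulrC.
apply: attains_bind ab _ => Gam2 le2 kb.
have := attains_mulmx kb (mx_known_refines (refines_trans le2 le1) kr).
rewrite mul1n => abr.
rewrite (_ : 3 * _ = alpha * n * 2 + alpha * n * 1)%N; last by rewrite -mulnDr mulnC.
apply: attains_bind abr _ => Gam3 le3 kbr; apply: update kbr.
exact: mx_known_refines (refines_trans le3 (refines_trans le2 le1)) kB.
Qed.

End MatrixAlgorithms.

(** * The elimination procedure *)

(** Cutting a row that starts with [d] zeros commutes with cutting the matrix,
    whatever the entries that are cut away. *)
Lemma colsub_trail_mul (C : fieldType) n d (v : 'rV[C]_n) (X : 'M[C]_n) :
  (forall j : 'I_n, (j < d)%N -> v 0 j = 0) ->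
  colsub (@trail_ord n d) (v *m X) = colsub (@trail_ord n d) v *m trail_mx d X.
Proof.
move=> v0; apply/rowP => j; rewrite !mxE.
have inj_trail : injective (@trail_ord n d).
  by move=> a b /(congr1 val) /= /addnI/val_inj.
rewrite (bigID (fun l : 'I_n => (d <= l)%N)) /= addrC big1 ?add0r => [|l]; last first.
  by rewrite -ltnNge => /v0->; rewrite mul0r.
pose h l := v 0 l * X l (trail_ord j).
transitivity (\sum_(l in [set trail_ord m | m in [set: 'I_(n - d)]]) h l).
  apply: eq_bigl => l; apply/idP/imsetP => [le_dl|[m _ -> /=]]; last exact: leq_addr.
  have lt_ld : (l - d < n - d)%N by rewrite ltn_sub2r // (leq_ltn_trans le_dl).
  by exists (Ordinal lt_ld) => //; apply: val_inj; rewrite /= subnKC.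
rewrite big_imset /=; last by move=> ? ? _ _ /inj_trail.
by apply: eq_big => [l|l _]; rewrite ?inE // !mxE.
Qed.

(** Inputs form an arbitrary type here, with the two subroutines correct on
    every input; [node s z] says that [z] is one of the nodes of the input [s],
    which is invariant under row interchanges. *)
Section Procedure.
Variables (C : numFieldType) (w n alpha N1 N2 : nat) (I : Type).
Variables (Q : I -> recsys C n) (A : I -> 'M[C]_n) (node : I -> C -> Prop).
Hypothesis node_neq0 : forall s z, node s z -> z != 0.
Hypothesis solver : forall d : 'I_n,
  exists t : act C 'I_(n - d) (solve_var n (n - d)),
    (cost w t <= N1)%N /\
    forall s z, node s z -> forall b : 'rV[C]_(n - d),
    exists y, run t (solve_env (Q s) z b) = Some y /\
      (\row_j y j) *m (trail_mx d (M_mx (Q s)) - z *: trail_mx d (N_mx (Q s))) = b.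
Hypothesis multiplier : forall d : 'I_n,
  exists t : act C 'I_(n - d) (mul_var n (n - d)),
    (cost w t <= N2)%N /\
    forall s (b : 'rV[C]_(n - d)),
    exists y, run t (mul_env (Q s) b) = Some y /\
      \row_j y j = b *m trail_mx d (M_mx (Q s)).

Implicit Type Gam : context C I.

Definition coef_known Gam := forall v, known Gam (fun s => coef_env (Q s) v).

Lemma coef_known_refines Gam' Gam :
  refines Gam' Gam -> coef_known Gam -> coef_known Gam'.
Proof. by move=> le kc v; apply: known_refines le _. Qed.

(** The pivot row [r], from [v], the row of G B at the pivot.  The shifted
    trailing block is unit upper triangular, so the solution that the subroutine
    returns is the expected one. *)
Lemma attains_solve (d : 'I_n) (z : I -> C) (v r : I -> 'rV[C]_n) Gam :
  coef_known Gam -> known Gam z -> mx_known v Gam ->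
  (forall s, holds Gam s -> node s (z s)) ->
  (forall s, holds Gam s -> forall j : 'I_n, (j < d)%N -> v s 0 j = 0) ->
  (forall s, holds Gam s -> forall j : 'I_n, (j < d)%N -> r s 0 j = 0) ->
  (forall s, holds Gam s ->
     r s *m (M_mx (Q s) - z s *: N_mx (Q s)) = z s *: (v s *m M_mx (Q s))) ->
  attains w (mx_known r) (N2 + (n + N1)) Gam.
Proof.
move=> kc kz kv node_z v0 r0 rP.
have [tm [cm tmP]] := multiplier d; have [ts [cs tsP]] := solver d.
pose tr (u : 'rV[C]_n) := colsub (@trail_ord n d) u.
pose f j s := (tr (v s) *m trail_mx d (M_mx (Q s))) 0 j.
have am : attains w (fun Gam' => forall j, known Gam' (f j)) N2 Gam.
  apply: attains_leq cm _.
  apply: (attains_run w (s := fun u s => mul_env (Q s) (tr (v s)) u)).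
    case=> [u|j] /=; first exact: kc.
    by apply: eq_known (kv 0 (trail_ord j)) => s _; rewrite mxE.
  move=> s Hs; have [y [-> yP]] := tmP s (tr (v s)).
  by congr Some; apply: funext => j; rewrite /f -yP mxE.
apply: attains_bind am _ => Gam1 le1 kf.
pose g j s := z s * f j s.
have ag : attains w (fun Gam' => forall j, known Gam' (g j)) n Gam1.
  apply: (@attains_leq _ _ _ _ _ (#|'I_(n - d)| * 1)).
    by rewrite card_ord muln1 leq_subr.
  apply: attains_family => j.
  exact: (attains_mul (attains_known _ (known_refines le1 kz)) (attains_known _ (kf j))).
apply: attains_bind ag _ => Gam2 le2 kg; have le21 := refines_trans le2 le1.
pose h j s := r s 0 (@trail_ord n d j).
have ah : attains w (fun Gam' => forall j, known Gam' (h j)) N1 Gam2.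
  apply: attains_leq cs _.
  apply: (attains_run w (s := fun u s => solve_env (Q s) (z s) (\row_j g j s) u)).
    case=> [u||j] /=; first exact: known_refines le21 (kc u).
      exact: known_refines le21 kz.
    by apply: eq_known (kg j) => s _; rewrite mxE.
  move=> s /le21.1 Hs; have [y [-> yP]] := tsP s _ (node_z s Hs) (\row_j g j s).
  congr Some; apply: funext => j.
  suff /rowP/(_ j) : \row_j y j = tr (r s) by rewrite !mxE.
  apply: (can_inj (mulmxK (shifted_M_mx_unit (Q s) d (z s)))).
  rewrite yP -[RHS](_ : tr (r s *m (M_mx (Q s) - z s *: N_mx (Q s))) = _); last first.
    rewrite /tr colsub_trail_mul; last exact: r0.
    by congr (_ *m _); apply/matrixP => a b; rewrite !mxE.
  rewrite rP //; apply/rowP => j'; rewrite /g /f /tr -colsub_trail_mul; last exact: v0.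
  by rewrite ![in LHS]mxE ![in RHS]mxE.
rewrite -(addn0 N1); apply: attains_bind ah _ => Gam3 le3 kh.
apply: (@attains_leq _ _ _ _ _ (1 * n * 0)); first by rewrite muln0.
apply: attains_mx => i j; rewrite (ord1 i).
have [lt_jd|le_dj] := ltnP j d.
  apply: eq_attains (attains_cst _ _ 0) => s Hs.
  by rewrite r0 //; apply: le21.1; apply: le3.1.
have lt_jd : (j - d < n - d)%N by rewrite ltn_sub2r // (leq_ltn_trans le_dj).
apply: eq_attains (attains_known _ (kh (Ordinal lt_jd))) => s _.
by rewrite /h; congr (r s 0 _); apply: val_inj; rewrite /= subnKC.
Qed.

(** After [d] steps the finished entries of the compact storage are known, and
    the trailing part is known through its generator only.  The permutation
    depends on the branch, not on the input: it is fixed within a context. *)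
Definition stage d Gam := exists (P : 'M[C]_n) (S : I -> 'M[C]_n)
    (x : I -> 'I_n -> C) (G : I -> 'M[C]_(n, alpha)) (B : I -> 'M[C]_(alpha, n)),
  [/\ forall s, holds Gam s ->
        [/\ gepp_run (A s) d P (S s), forall j, node s (x s j)
          & Dinv_mx (x s) *m trailing d (S s) - trailing d (S s) *m W_mx (Q s)
            = G s *m B s],
      forall j, known Gam (fun s => x s j), mx_known G Gam, mx_known B Gam
    & forall i j : 'I_n, (i < d)%N || (j < d)%N -> known Gam (fun s => S s i j)].

Lemma displacement_xrow k q s (x : 'I_n -> C) (T : 'M[C]_n)
    (G : 'M[C]_(n, alpha)) (B : 'M[C]_(alpha, n)) :
  Dinv_mx x *m T - T *m W_mx (Q s) = G *m B ->
  Dinv_mx (x \o tperm k q) *m xrow k q T - xrow k q T *m W_mx (Q s) = xrow k q G *m B.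
Proof.
move=> TD; rewrite !xrowE -!mulmxA -TD mulmxBr -xrowE; congr (_ - _).
by rewrite /Dinv_mx !mul_diag_mx -xrowE; apply/matrixP => i j; rewrite !mxE.
Qed.

(** Per step, in units of operations: about 2 alpha n for the pivot column and
    for the row of G B, 3 alpha n for each of the two generator updates, and a
    multiple of n + alpha for scalings and divisions; the search for the pivot and the
    test against zero use n + 1 comparisons.  As alpha > 0, all of this fits
    into [(14 + 2 * w) * (alpha * n)]. *)
Lemma attains_step (k : 'I_n) Gam : (0 < alpha)%N ->
  coef_known Gam -> stage k Gam ->
  attains w (stage k.+1) ((14 + 2 * w) * (alpha * n) + N1 + N2) Gam.
Proof.
move=> alpha_gt0 kc [P [S [x [G [B [inv kx kG kB kS]]]]]].
have gen_col s : holds Gam s -> forall j,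
    trailing k (S s) j k = x s j * (G s *m col k (B s)) j 0.
  move=> Hs j; have [_ nodes disp] := inv s Hs.
  rewrite (generated_col (fun i => node_neq0 (nodes i)) disp); last first.
    by move=> i j' lt_j'k; rewrite mxE [(k <= j')%N]leqNgt lt_j'k andbF.
  by congr (_ * _); rewrite colE mulmxA -colE [RHS]mxE.
have kb : mx_known (fun s => col k (B s)) Gam.
  by move=> i j; apply: eq_known (kB i k) => s _; rewrite mxE.
pose l j s := trailing k (S s) j k.
have al : attains w (fun Gam' => forall j, known Gam' (l j))
    (n * 1 * (alpha * 2) + n) Gam.
  apply: attains_bind (attains_mulmx w kG kb) _ => Gam1 le1 kGb.
  apply: (@attains_leq _ _ _ _ _ (#|'I_n| * 1)); first by rewrite card_ord muln1.
  apply: attains_family => j.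
  apply: eq_attains (attains_mul (attains_known _ (known_refines le1 (kx j)))
    (attains_known _ (kGb j 0))) => s /le1.1 Hs.
  exact: gen_col.
(* In order: pivot column, pivot search, row of G B, pivot row, update. *)
apply: (@attains_leq _ _ _ _ _ ((n * 1 * (alpha * 2) + n) + (n * w +
  (1 * n * (alpha * 2) + ((N2 + (n + N1)) + (w + (n + (3 * (n * alpha) +
  (alpha + 3 * (alpha * n)))) + 0))))))%N.
  have n_gt0 : (0 < n)%N by apply: leq_trans (ltn_ord k).
  have [le_n le_a] : (n <= alpha * n)%N /\ (alpha <= alpha * n)%N.
    by split; [apply: leq_pmull|apply: leq_pmulr].
  have : (w <= w * n)%N by apply: leq_pmulr.
  have : (w * n <= w * (alpha * n))%N by rewrite leq_mul2l le_n orbT.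
  rewrite mul1n muln1 (_ : n * (alpha * 2) = 2 * (alpha * n))%N; last by lia.
  rewrite mulnDl -mulnA [(n * alpha)%N]mulnC [(n * w)%N]mulnC.
  move: (alpha * n)%N (w * n)%N (w * (alpha * n))%N le_n le_a => an wn wan.
  lia.
apply: attains_bind al _ => Gam1 le1 kl.
apply: attains_bind (attains_pivot w (ltn_ord k) kl) _ => Gam2 le2 [q le_kq max_q].
have le21 := refines_trans le2 le1.
have piv s : holds Gam2 s -> partial_pivot k q (S s).
  move=> Hs; split=> // i le_ki.
  by have := max_q s Hs i le_ki; rewrite /l !mxE le_ki le_kq leqnn.
pose T s := trailing k (xrow k q (S s)).
pose x' s := x s \o tperm k q.
pose G' s := xrow k q (G s).
have TE s : T s = xrow k q (trailing k (S s)) by apply: trailing_xrow.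
have x'0 s : holds Gam2 s -> forall j, x' s j != 0.
  by move=> /le21.1/inv[_ nodes _] j; apply: node_neq0 (nodes _).
have TD s : holds Gam2 s ->
    Dinv_mx (x' s) *m T s - T s *m W_mx (Q s) = G' s *m B s.
  by move=> /le21.1/inv[_ _ disp]; rewrite TE; apply: displacement_xrow.
have T0 s i (j : 'I_n) : (j < k)%N -> T s i j = 0.
  by move=> lt_jk; rewrite mxE [(k <= j)%N]leqNgt lt_jk andbF.
have kG' : mx_known G' Gam2.
  move=> i j; apply: eq_known (known_refines le21 (kG (tperm k q i) j)) => s _.
  by rewrite mxE.
have kg : mx_known (fun s => row k (G' s)) Gam2.
  by move=> i j; apply: eq_known (kG' k j) => s _; rewrite mxE.
have av := attains_mulmx w kg (mx_known_refines le21 kB).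
apply: attains_bind av _ => Gam3 le3 kv; have le31 := refines_trans le3 le21.
have ar : attains w (mx_known (fun s => row k (T s))) (N2 + (n + N1)) Gam3.
  apply: (attains_solve (d := k) (z := fun s => x' s k)
            (v := fun s => row k (G' s) *m B s)).
  - exact: coef_known_refines le31 kc.
  - exact: known_refines le31 (kx (tperm k q k)).
  - exact: kv.
  - by move=> s /le31.1/inv[_ nodes _]; apply: nodes.
  - move=> s /le3.1 Hs j lt_jk; rewrite -row_mul mxE.
    rewrite (generated_entry (TD s Hs) (T0 s)); last exact: ltnW.
    by rewrite T0 // mulr0.
  - by move=> s _ j lt_jk; rewrite mxE T0.
  - by move=> s /le3.1 Hs; apply: (generated_row_solve (x'0 s Hs) (TD s Hs)).
apply: attains_bind ar _ => Gam4 le4 kr; have le42 := refines_trans le4 le3.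
have le41 := refines_trans le42 le21.
have kT i : known Gam4 (fun s => T s i k).
  apply: eq_known (known_refines (refines_trans le42 le2) (kl (tperm k q i))) => s _.
  by rewrite TE /l mxE.
apply: attains_bind (attains_schur w kT kr (mx_known_refines le42 kG')
  (mx_known_refines le41 kB)) _ => Gam5 le5 [km kG5 kB5].
have le52 := refines_trans le5 le42; have le51 := refines_trans le52 le21.
apply: AttDone; exists (P *m tperm_mx k q), (fun s => gepp_step k q (S s)), x'.
exists (fun s => G' s - multipliers (T s) k *m row k (G' s)).
exists (fun s => B s - (T s k k)^-1 *: col k (B s) *m row k (T s)); split=> //.
- move=> s /le52.1 Hs; have [run nodes _] := inv s (le21.1 s Hs).
  split=> [|j|]; first exact: GeppStep run (piv s Hs).
    exact: nodes.
  rewrite trailing_gepp_step; last exact: piv.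
  apply: displacement_schur => //; [exact: x'0|exact: TD|exact: T0|].
  move=> p0 i; have [lt_ik|le_ki] := ltnP i k.
    by rewrite mxE [(k <= i)%N]leqNgt lt_ik.
  rewrite mxE le_ki leqnn; apply: (pivot_eq0 (piv s Hs)) => //.
  by move: p0; rewrite mxE leqnn.
- by move=> j; apply: known_refines le51 (kx (tperm k q j)).
move=> i j; rewrite !ltnS => le_ij.
case: (boolP ((i < k)%N || (j < k)%N)) => [lt_ij|].
  apply: (eq_known (f := fun s => S s (tperm k q i) j)) => [s _|].
    by rewrite !mxE; case/orP: lt_ij => [/ltnW ->|->]; rewrite ?orbT.
  apply: known_refines le51 (kS _ _ _).
  case/orP: lt_ij => [lt_ik|->]; last by rewrite orbT.
  rewrite tpermD ?lt_ik // -val_eqE gtn_eqF //; exact: leq_trans lt_ik le_kq.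
rewrite negb_or -!leqNgt => /andP[le_ki le_kj].
case: (eqVneq i k) le_ij => [-> _|ne_ik le_ij].
  apply: eq_known (known_refines le5 (kr 0 j)) => s _.
  by rewrite !mxE leqnn le_kj.
have lt_ki : (k < i)%N by rewrite ltn_neqAle eq_sym ne_ik.
have -> : j = k.
  by apply/val_inj/eqP; rewrite eqn_leq le_kj andbT; rewrite leqNgt lt_ki in le_ij.
apply: eq_known (km i 0) => s _.
rewrite ![gepp_step _ _ _ _ _]mxE ltnn orbF leqNgt lt_ki eqxx /=.
rewrite ![multipliers _ _ _ _]mxE ![T _ _ _]mxE le_ki leqnn /= (negPf ne_ik).
by case: eqP => // ->; rewrite invr0 mulr0.
Qed.

Lemma attains_stage d Gam : (0 < alpha)%N -> (d <= n)%N ->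
  coef_known Gam -> stage 0 Gam ->
  attains w (stage d) (d * ((14 + 2 * w) * (alpha * n) + N1 + N2)) Gam.
Proof.
move=> alpha_gt0 + kc st0; elim: d => [|d IH] lt_dn; first exact: AttDone.
rewrite mulSnr; apply: attains_bind (IH (ltnW lt_dn)) _ => Gam1 le1 std.
exact: (attains_step (k := Ordinal lt_dn) alpha_gt0 (coef_known_refines le1 kc) std).
Qed.

Definition is_gepp s (y : lu_out n -> C) :=
  let P := \matrix_(i, j) y (OutP i j) in
  let L := \matrix_(i, j) y (OutL i j) in
  let U := \matrix_(i, j) y (OutU i j) in
  A s = P *m L *m U /\ gepp (A s) P L U.

(** Writing down the result is free: its entries are known or constant. *)
Lemma attains_is_gepp (P : 'M[C]_n) (S : I -> 'M[C]_n) Gam :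
  (forall s, holds Gam s -> gepp_run (A s) n P (S s)) -> mx_known S Gam ->
  attains w (answers is_gepp) 0 Gam.
Proof.
move=> run kS.
have free m p (F : I -> 'M[C]_(m, p)) Gam' :
    (forall i j, attains w (known^~ (fun s => F s i j)) 0 Gam') ->
    attains w (mx_known F) 0 Gam'.
  move=> aF; apply: (@attains_leq _ _ _ _ _ (m * p * 0)); first by rewrite muln0.
  exact: attains_mx.
have aP : attains w (mx_known (fun=> P)) 0 Gam by apply: free => i j; apply: attains_cst.
have aL Gam' : refines Gam' Gam -> attains w (mx_known (fun s => unit_lower (S s))) 0 Gam'.
  move=> le; apply: free => i j; case lt_ji: (j < i)%N.
    apply: eq_attains (attains_known _ (known_refines le (kS i j))) => s _.
    by rewrite mxE lt_ji.
  by apply: eq_attains (attains_cst _ _ (i == j)%:R) => s _; rewrite mxE lt_ji.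
have aU Gam' : refines Gam' Gam -> attains w (mx_known (fun s => upper (S s))) 0 Gam'.
  move=> le; apply: free => i j; case le_ij: (i <= j)%N.
    apply: eq_attains (attains_known _ (known_refines le (kS i j))) => s _.
    by rewrite mxE le_ij.
  by apply: eq_attains (attains_cst _ _ 0) => s _; rewrite mxE le_ij.
rewrite -[0%N]/(0 + (0 + (0 + 0)))%N; apply: attains_bind aP _ => Gam1 le1 kP.
apply: attains_bind (aL _ le1) _ => Gam2 le2 kL; have le21 := refines_trans le2 le1.
apply: attains_bind (aU _ le21) _ => Gam3 le3 kU; have le31 := refines_trans le3 le21.
apply: AttDone.
exists (fun o s => match o with
  | OutP i j => P i j | OutL i j => unit_lower (S s) i j | OutU i j => upper (S s) i j
  end); split=> [[] i j|s /le31.1/run/gepp_run_spec].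
- exact: known_refines (refines_trans le3 le2) (kP i j).
- exact: known_refines le3 (kL i j).
- exact: kU.
rewrite /is_gepp.
have -> : \matrix_(i, j) P i j = P by apply/matrixP => i j; rewrite mxE.
have -> : \matrix_(i, j) unit_lower (S s) i j = unit_lower (S s).
  by apply/matrixP => i j; rewrite mxE.
have -> : \matrix_(i, j) upper (S s) i j = upper (S s).
  by apply/matrixP => i j; rewrite mxE.
by case.
Qed.

End Procedure.

(** Column by column: the columns before [j] vanish, hence column [j] is
    generated by G B = 0. *)
Lemma displacement_rank0 (C : fieldType) n (Q : recsys C n) x (A : 'M[C]_n)
    (G : 'M[C]_(n, 0)) (B : 'M[C]_(0, n)) :
  (forall i, x i != 0) -> Dinv_mx x *m A - A *m W_mx Q = G *m B -> A = 0.
Proof.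
move=> x0 disp; apply/matrixP => i j; rewrite [RHS]mxE.
have [p le_jp] := ubnP j; elim: p i j le_jp => // p IH i j; rewrite ltnS => le_jp.
rewrite (generated_col x0 disp); first by rewrite mxE big_ord0 mulr0.
by move=> i' j' lt_j'j; apply: IH; apply: leq_trans lt_j'j le_jp.
Qed.

Section Instances.
Variables (C : numFieldType) (n alpha : nat).
Variable K : recsys C n -> ('I_n -> C) -> Prop.

(** Bundling the hypotheses with the data makes every input admissible, so the
    initial context carries no condition. *)
Record instance := Instance {
  in_sys : recsys C n;
  in_node : 'I_n -> C;
  in_mx : 'M[C]_n;
  in_left : 'M[C]_(n, alpha);
  in_right : 'M[C]_(alpha, n);
  in_class : K in_sys in_node;
  in_disp : Dinv_mx in_node *m in_mx - in_mx *m W_mx in_sys = in_left *m in_right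
}.

Definition in_env (v : lu_var n alpha) (s : instance) :=
  lu_env (in_sys s) (in_node s) (in_left s) (in_right s) v.

Theorem plu_bound_displacement w N1 N2 :
  (forall Q x, K Q x -> forall i, x i != 0) ->
  solve_bound w K N1 -> mul_bound w K N2 ->
  plu_bound w alpha K ((14 + 2 * w) * (alpha * n ^ 2) + n * N1 + n * N2).
Proof.
move=> K0 solver multiplier.
pose Gam := MkContext (fun _ : instance => True) (fun f => exists v, f = in_env v).
have known_in v : known Gam (in_env v) by exists (in_env v) => //; exists v.
suff /attains_sound/(_ _ in_env)[] : attains w (answers (is_gepp in_mx))
    ((14 + 2 * w) * (alpha * n ^ 2) + n * N1 + n * N2) Gam.
- by move=> f [v ->]; exists v.
- move=> t [ct tP]; exists t; split=> // Q x KQx A G B disp.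
  exact: (tP (Instance KQx disp) Logic.I).
have [alpha0|alpha_gt0] := posnP alpha.
  apply: (@attains_leq _ _ _ _ _ (n * n * 0 + 0)); first by rewrite muln0.
  have a0 : attains w (mx_known (fun _ : instance => 0 : 'M[C]_n)) (n * n * 0) Gam.
    apply: attains_mx => i j.
    by apply: eq_attains (attains_cst _ _ 0) => s _; rewrite mxE.
  apply: attains_bind a0 _ => Gam1 _.
  apply: (attains_is_gepp w (P := 1%:M)) => s _.
  suff -> : in_mx s = 0 by apply: gepp_run0.
  move: (in_left s) (in_right s) (in_disp s); rewrite alpha0 => G B.
  by apply: displacement_rank0; apply: K0 (in_class s).
apply: (@attains_leq _ _ _ _ _ (n * ((14 + 2 * w) * (alpha * n) + N1 + N2) + 0)).
  rewrite addn0; move: (14 + 2 * w)%N => c.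
  by rewrite !mulnDr mulnCA (mulnCA n alpha) mulnn.
pose node (s : instance) z := exists i, z = in_node s i.
have kc : coef_known in_sys Gam by move=> v; apply: known_in (LUCoef alpha v).
have st0 : stage alpha in_sys in_mx node 0 Gam.
  exists 1%:M, in_mx, in_node, in_left, in_right; split=> //.
  - move=> s _; split; [exact: GeppStart|by move=> j; exists j|].
    rewrite (_ : trailing 0 _ = in_mx s) ?in_disp //.
    by apply/matrixP => i j; rewrite mxE.
  - by move=> j; apply: known_in (LUNode alpha j).
  - by move=> i j; apply: known_in (LUG i j).
  - by move=> i j; apply: known_in (LUB i j).
have att : attains w (stage alpha in_sys in_mx node n)
    (n * ((14 + 2 * w) * (alpha * n) + N1 + N2)) Gam.
  apply: attains_stage => //.
  - by move=> s _ [i ->]; apply: K0 (in_class s) i.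
  - move=> d; have [t [ct tP]] := solver d; exists t; split=> // s _ [i ->] b.
    exact: tP (in_class s) i b.
  - move=> d; have [t [ct tP]] := multiplier d; exists t; split=> // s b.
    exact: tP (in_class s) b.
apply: attains_bind att _ => Gam1 _ [P [S [x [G [B [inv _ _ _ kS]]]]]].
apply: (attains_is_gepp w (P := P) (S := S)) => [s /inv[] //|i j].
by apply: kS; rewrite ltn_ord.
Qed.

End Instances.

Theorem theorem2p3 (R : realType) (w : nat) :
  exists c : nat,
  forall (n alpha : nat) (K : recsys R[i] n -> ('I_n -> R[i]) -> Prop)
    (C1 C2 : nat -> nat),
  (forall (Q : recsys R[i] n) (x : 'I_n -> R[i]), K Q x ->
     forall i : 'I_n, x i != 0) ->
  solve_bound w K (C1 n) ->
  mul_bound w K (C2 n) ->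
  plu_bound w alpha K (c * (alpha * n ^ 2) + n * C1 n + n * C2 n).
Proof.
exists (14 + 2 * w)%N => n alpha K C1 C2 K0 solver multiplier.
exact: plu_bound_displacement.
Qed.
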